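(* Let $\Delta$ be the marked group $\mathbb{Z}\rtimes_\varphi\mathbb{Z}$, where $\varphi:\mathbb{Z}\to\mathrm{Aut}(\mathbb{Z})$ sends $1$ to the inversion map (so the product is $(a,m)(b,n)=(a+(-1)^m b,m+n)$), with generating set $\{(\pm 2,0),(\pm 3,0),(0,1),(0,-1)\}$. Then $\chi_B(F(2^\Delta))>3$.
   Context: A marked group is a finitely generated group $\Gamma$ with a finite symmetric generating set $S$ not containing the identity. The left shift action of $\Gamma$ on $2^\Gamma$ is $(g\cdot x)(h)=x(g^{-1}h)$; its free part is $F(2^\Gamma)=\{x\in 2^\Gamma : g\cdot x\neq x \text{ for all } g\neq \mathrm{id}\}$. The shift graph $F(2^\Gamma)$ is the graph on this free part joining distinct $x,y$ iff $s\cdot x=y$ for some $s\in S$. $\chi_B(G)$ denotes the Borel chromatic number: the least $k$ such that there is a Borel map $c$ from the vertex set to a $k$-element set with $c(x)\neq c(y)$ for adjacent $x,y$. *)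

(* Defs.v *)
From HB Require Import structures.
From mathcomp Require Import all_boot all_order all_algebra.
From mathcomp Require Import all_classical all_reals all_analysis.

Set Implicit Arguments.
Unset Strict Implicit.
Unset Printing Implicit Defensive.

Import Order.TTheory GRing.Theory Num.Theory.

Local Open Scope classical_set_scope.
Local Open Scope ring_scope.

Record marked_group := MarkedGroup {
  mg_group :> groupType;
  mg_gens : seq mg_group;
  mg_gens_sym : forall s, s \in mg_gens -> (s^-1)%g \in mg_gens;
  mg_gens_neq1 : (1%g : mg_group) \notin mg_gens;
  mg_gens_generate : forall g : mg_group,
    exists2 w : seq mg_group,
      {subset w <= mg_gens} & g = (\prod_(s <- w) s)%g
}.

Definition borel_set (X : topologicalType) : set (set X) := <<s (@open X) >>.

(* A graph on X is given by its adjacency relation E; the colour set 'I_k is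
   discrete, so every set of colours is Borel. *)
Definition borel_coloring (X : topologicalType) (E : X -> X -> Prop)
    (k : nat) (c : X -> 'I_k) : Prop :=
  (forall C : set 'I_k, borel_set (c @^-1` C)) /\
  (forall x y, E x y -> c x <> c y).

Definition borel_colorable (X : topologicalType) (E : X -> X -> Prop)
    (k : nat) : Prop :=
  exists c : X -> 'I_k, borel_coloring E c.

(* The least number of colours as an extended integer, with value +oo when no
   finite number of colours suffices. *)
Definition borel_chromatic_number (X : topologicalType) (E : X -> X -> Prop) :
    \bar int :=
  match pselect (exists k : nat, `[< borel_colorable E k >]) with
  | left ex => (ex_minn ex)%:Z%:E
  | right _ => +oo%E
  end.

Definition shift_space (G : groupType) : topologicalType :=
  prod_topology (fun _ : G => bool).

Definition shift (G : groupType) (g : G) (x : shift_space G) : shift_space G :=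
  fun h : G => x (g^-1 * h)%g.

Definition free_part (G : groupType) : set (shift_space G) :=
  [set x | forall g : G, g <> 1%g -> shift g x <> x].

(* set_type carries the subspace topology. *)
Definition shift_graph (G : marked_group) (x y : set_type (@free_part G)) :
    Prop :=
  x <> y /\ exists2 s, s \in mg_gens G & shift s (set_val x) = set_val y.

Definition Delta : Type := (int * int)%type.

HB.instance Definition _ := Choice.on Delta.

Definition Delta_mul (x y : Delta) : Delta :=
  (x.1 + (-1) ^ x.2 * y.1, x.2 + y.2).

Definition Delta_one : Delta := (0, 0).

Definition Delta_inv (x : Delta) : Delta := (- ((-1) ^ x.2 * x.1), - x.2).

Lemma N1_unit : (-1 : int) \is a GRing.unit. Proof. by []. Qed.

Lemma N1_mulV (m : int) : (-1 : int) ^ (- m) * (-1) ^ m = 1.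
Proof. by rewrite -exprzDr ?N1_unit // addNr expr0z. Qed.

Lemma N1_sqr (m : int) : (-1 : int) ^ m * (-1) ^ m = 1.
Proof. by rewrite -exprzMl ?N1_unit // mulrNN mulr1 exp1rz. Qed.

Lemma N1_opp (m : int) : (-1 : int) ^ (- m) = (-1) ^ m.
Proof. by rewrite -[LHS]mulr1 -[X in _ * X = _](N1_sqr m) mulrA N1_mulV mul1r. Qed.

Lemma Delta_mulA : associative Delta_mul.
Proof.
move=> [a m] [b n] [c p]; rewrite /Delta_mul /=.
by rewrite exprzDr ?N1_unit // !addrA mulrDr addrA mulrA.
Qed.

Lemma Delta_mul1 : left_id Delta_one Delta_mul.
Proof. by move=> [a m]; rewrite /Delta_mul /= expr0z mul1r !add0r. Qed.

Lemma Delta_mulr1 : right_id Delta_one Delta_mul.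
Proof. by move=> [a m]; rewrite /Delta_mul /= mulr0 !addr0. Qed.

Lemma Delta_mulV : left_inverse Delta_one Delta_inv Delta_mul.
Proof. by move=> [a m]; rewrite /Delta_mul /= N1_opp !addNr. Qed.

Lemma Delta_mulrV : right_inverse Delta_one Delta_inv Delta_mul.
Proof.
by move=> [a m]; rewrite /Delta_mul /= mulrN mulrA N1_sqr mul1r !addrN.
Qed.

HB.instance Definition _ := isGroup.Build Delta
  Delta_mulA Delta_mul1 Delta_mulr1 Delta_mulV Delta_mulrV.

Definition Delta_gens : seq Delta :=
  [:: (2, 0); (- 2, 0); (3, 0); (- 3, 0); (0, 1); (0, - 1)].

Lemma Delta_gens_sym (s : Delta) :
  s \in Delta_gens -> (s^-1)%g \in Delta_gens.
Proof. by rewrite !inE => /or4P[||| /or3P[]] /eqP ->. Qed.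

Lemma Delta_gens_neq1 : (1%g : Delta) \notin Delta_gens.
Proof. by []. Qed.

(* (1, 0) = (3, 0) (-2, 0), so (a, m) is a product of |a| factors (+-1, 0)
   followed by |m| factors (0, +-1). *)
Lemma Delta_gens_generate (g : Delta) :
  exists2 w : seq Delta,
    {subset w <= Delta_gens} & g = (\prod_(s <- w) s)%g.
Proof.
pose P (x : Delta) := exists2 w : seq Delta,
  {subset w <= Delta_gens} & x = (\prod_(s <- w) s)%g.
have PM x y : P x -> P y -> P (x * y)%g.
  move=> [u uS ->] [v vS ->]; exists (u ++ v); last by rewrite big_cat.
  by move=> z; rewrite mem_cat => /orP[/uS|/vS].
have PX x n : P x -> P (x ^+ n)%g.
  move=> Px; elim: n => [|n IHn]; last by rewrite expgS; exact: PM.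
  by exists [::]; rewrite ?big_nil ?expg0.
have PS x : x \in Delta_gens -> P x.
  by move=> xS; exists [:: x]; [move=> z; rewrite inE => /eqP -> | rewrite big_seq1].
have X0 (a : int) n : (((a, 0) : Delta) ^+ n)%g = (a *+ n, 0) :> Delta.
  elim: n => [|n IHn]; first by rewrite expg0.
  rewrite expgS IHn mulrS.
  by congr pair; rewrite /= ?expr0z ?mul1r ?addr0.
have X1 (m : int) n : (((0, m) : Delta) ^+ n)%g = (0, m *+ n) :> Delta.
  elim: n => [|n IHn]; first by rewrite expg0.
  by rewrite expgS IHn mulrS; congr pair; rewrite /= mulr0 addr0.
have Pa (a : int) : P (a, 0).
  have P1 : P (1, 0) by apply: (PM (3, 0) (-2, 0)); apply: PS.
  have PN1 : P (-1, 0) by apply: (PM (2, 0) (-3, 0)); apply: PS.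
  case: a => n.
    by have := PX _ n P1; rewrite X0 natz.
  by have := PX _ n.+1 PN1; rewrite X0 mulNrn natz -NegzE.
have Pm (m : int) : P (0, m).
  case: m => n.
    by have := PX (0, 1) n (PS (0, 1) isT); rewrite X1 natz.
  have := PX (0, -1) n.+1 (PS (0, -1) isT).
  by rewrite X1 mulNrn natz -NegzE.
case: g => a m; have := PM _ _ (Pa a) (Pm m).
by congr P; congr pair; rewrite /= ?mulr0 ?addr0 ?add0r.
Qed.

Definition Delta_marked : marked_group :=
  MarkedGroup Delta_gens_sym Delta_gens_neq1 Delta_gens_generate.

(* Main.v *)
(* A 3-colouring is a map to a triangle, so it has a winding number along every
   closed walk.  It is 0 along 4-cycles and, by parity, nonzero along the
   pentagons x, 2x, 4x, 6x, 3x (writing k for (k, 0)).  Pushing a pentagon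
   across the edges (0, 1) preserves its winding number but reverses its
   orientation, so the sign of the winding number is a Borel function that
   changes under the element (-6, 1) of infinite order.  This contradicts Baire
   category: the sign is constant on a comeagre subset of some cylinder, and
   that cylinder meets its translate by a large odd power of (-6, 1). *)

Require Import Defs.
From HB Require Import structures.
From mathcomp Require Import all_boot all_order all_algebra.
From mathcomp Require Import all_classical all_reals all_analysis.
From mathcomp Require Import zify.

(* mathcomp-analysis exports another [shift]. *)
Import Defs.

Set Implicit Arguments.
Unset Strict Implicit.
Unset Printing Implicit Defensive.

Import Order.TTheory GRing.Theory Num.Theory.

Local Open Scope classical_set_scope.
Local Open Scope ring_scope.

(** * Baire category in the Cantor space over a countable index type *)

Section CantorCategory.
Variable T : countType.
Local Notation X := (T -> bool).
Implicit Types (x y : X) (s : seq bool) (n : nat) (O D M : set X).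

(* Cylinders are indexed by bit strings through the numbering [pickle];
   positions that are not the code of any element of [T] carry no constraint. *)
Definition agree n x y := forall h, (pickle h < n)%N -> x h = y h.

Definition point_of s : X := fun h => nth false s (pickle h).

Definition cylinder s : set X := [set x | agree (size s) x (point_of s)].

Definition cyl_open O := forall x, O x -> exists n, agree n x `<=` O.

Definition cyl_dense D := forall s, exists2 x, cylinder s x & D x.

Definition meagre M := exists D : nat -> set X,
  (forall n, cyl_open (D n) /\ cyl_dense (D n)) /\
  forall x, (forall n, D n x) -> ~ M x.

Lemma agree_trans n x y z : agree n x y -> agree n y z -> agree n x z.
Proof. by move=> xy yz h hn; rewrite xy ?yz. Qed.

Lemma agree_sym n x y : agree n x y -> agree n y x.
Proof. by move=> xy h hn; rewrite xy. Qed.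

Lemma agree_le m n x y : (m <= n)%N -> agree n x y -> agree m x y.
Proof. by move=> mn xy h hm; apply: xy; exact: leq_trans mn. Qed.

Lemma cylinder_point_of s : cylinder s (point_of s).
Proof. by []. Qed.

Lemma cylinder_open s : cyl_open (cylinder s).
Proof.
by move=> x sx; exists (size s) => y xy; exact: agree_trans (agree_sym xy) sx.
Qed.

Lemma cyl_openI O D : cyl_open O -> cyl_open D -> cyl_open (O `&` D).
Proof.
move=> oO oD x [/oO[m Om] /oD[n Dn]]; exists (maxn m n) => y xy.
split; [apply: Om|apply: Dn]; apply: agree_le xy; lia.
Qed.

Lemma cyl_open_cylinder O x n : cyl_open O -> O x ->
  exists s, [/\ cylinder s x, cylinder s `<=` O & (n <= size s)%N].
Proof.
move=> oO /oO[m Om].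
pose s := mkseq (fun i => oapp x false (unpickle i)) (maxn m n).
have xs : agree (maxn m n) x (point_of s).
  by move=> h hm; rewrite /point_of nth_mkseq // pickleK.
have sz : size s = maxn m n by rewrite size_mkseq.
exists s; rewrite /cylinder /= sz; split=> //; last lia.
move=> y /= ys; apply: Om.
apply: (@agree_le _ (maxn m n)); first lia.
exact: agree_trans xs (agree_sym ys).
Qed.

Lemma cyl_dense_meets D O x :
  cyl_dense D -> cyl_open O -> O x -> exists2 y, O y & D y.
Proof.
move=> dD oO Ox; have [s [_ sO _]] := cyl_open_cylinder 0 oO Ox.
by have [y /sO] := dD s; exists y.
Qed.

Lemma pickle_bounded (f : T -> nat) n :
  exists m, forall h, (pickle h < n)%N -> (f h < m)%N.
Proof.
exists (\max_(i < n) oapp f 0%N (unpickle i)).+1 => h hn.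
by have := leq_bigmax (Ordinal hn)
  (F := fun i : 'I_n => oapp f 0%N (unpickle i)); rewrite /= pickleK.
Qed.

(** Reindexing is continuous: the first [n] coordinates of [x \o f] are read from finitely many
    coordinates of [x]. *)
Lemma cyl_open_comp (f : T -> T) O :
  cyl_open O -> cyl_open [set x : X | O (x \o f)].
Proof.
move=> oO x /oO[n On]; have [m fm] := pickle_bounded (pickle \o f) n.
by exists m => y xy; apply: On => h /fm; exact: xy.
Qed.


Lemma baire_category s (D : nat -> set X) :
  (forall n, cyl_open (D n) /\ cyl_dense (D n)) ->
  exists2 x, cylinder s x & forall n, D n x.
Proof.
move=> oD.
have step n r : exists r', cylinder r' `<=` cylinder r `&` D n /\
    (n < size r')%N.
  have [x rx Dx] := (oD n).2 r.
  have oO := cyl_openI (@cylinder_open r) (oD n).1.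
  by have [r' [_ r'O nr']] := cyl_open_cylinder n.+1 oO (conj rx Dx); exists r'.
have [F FP] := choice (fun nr => step nr.1 nr.2).
pose S := nat_rect (fun=> seq bool) s (fun n r => F (n, r)).
have Snext n : cylinder (S n.+1) `<=` cylinder (S n) `&` D n.
  by have [] := FP (n, S n).
have Ssize n : (n < size (S n.+1))%N by have [] := FP (n, S n).
have Ssub m n : (m <= n)%N -> cylinder (S n) `<=` cylinder (S m).
  elim: n => [|n IHn]; first by rewrite leqn0 => /eqP ->.
  rewrite leq_eqVlt => /predU1P[->//|mn] x /Snext[+ _].
  exact: IHn.
(* The coordinate with code [i] is read off [S i.+1], whose length exceeds [i]; as the cylinders are
   nested, later strings agree with it there. *)
pose z : X := fun h => point_of (S (pickle h).+1) h.
have zS n : cylinder (S n) z.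
  move=> h hn; pose m := maxn n (pickle h).+1.
  have /(_ _ hn) <- := Ssub n m ltac:(lia) _ (@cylinder_point_of (S m)).
  apply/esym/(Ssub _ m _ _ (@cylinder_point_of (S m))); last exact: Ssize.
  by lia.
by exists z; [exact: (zS 0%N)|move=> n; have [] := Snext _ _ (zS n.+1)].
Qed.

Lemma meagre_sub M M' : M `<=` M' -> meagre M' -> meagre M.
Proof.
by move=> MM' [D [oD DM]]; exists D; split=> // x Dx /MM'; exact: DM.
Qed.

Lemma meagre0 : meagre set0.
Proof.
exists (fun=> setT); split=> [_|x _]; last exact.
by split; [move=> x _; exists 0%N|move=> s; exists (point_of s)].
Qed.

Lemma meagre_bigcup (I : countType) (M : I -> set X) :
  (forall i, meagre (M i)) -> meagre (\bigcup_i M i).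
Proof.
move=> /choice[D DP].
(* The double family [D i k] is listed along codes of pairs, with the whole space at numbers that
   code no pair. *)
pose E n :=
  if (unpickle n : option (I * nat)) is Some (i, k) then D i k else setT.
exists E; split=> [n|x Ex [i _]].
  rewrite /E; case: unpickle => [[i k]|]; first exact: (DP i).1.
  by split; [move=> x _; exists 0%N|move=> s; exists (point_of s)].
by apply: (DP i).2 => k; have := Ex (pickle (i, k)); rewrite /E pickleK.
Qed.

Lemma meagreU M M' : meagre M -> meagre M' -> meagre (M `|` M').
Proof.
move=> mM mM'; apply: (@meagre_sub _ (\bigcup_(b : bool) if b then M else M')).
  by move=> x [Mx|M'x]; [exists true|exists false].
by apply: meagre_bigcup => -[].
Qed.

Lemma meagre_nowhere_dense D :
  cyl_open D -> cyl_dense D -> meagre (~` D).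
Proof. by move=> oD dD; exists (fun=> D); split=> // x /(_ 0%N) Dx. Qed.

Lemma not_meagre_open O x : cyl_open O -> O x -> ~ meagre O.
Proof.
move=> oO Ox [D [oD DO]]; have [s [_ sO _]] := cyl_open_cylinder 0 oO Ox.
by have [y /sO Oy Dy] := baire_category s oD; exact: DO Dy Oy.
Qed.

Lemma meagre_comp (f g : T -> T) M : cancel f g -> cancel g f ->
  meagre M -> meagre [set x : X | M (x \o f)].
Proof.
move=> fK gK [D [oD DM]]; exists (fun n => [set x : X | D n (x \o f)]).
split=> [n|x Dx]; last exact: DM Dx.
split; first by apply: cyl_open_comp; exact: (oD n).1.
move=> s; have oO := cyl_open_comp (f := g) (@cylinder_open s).
have fgE (x : X) : (x \o f) \o g = x by apply/funext => h /=; rewrite gK.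
have gfE (x : X) : (x \o g) \o f = x by apply/funext => h /=; rewrite fK.
have [|y Oy Dy] := cyl_dense_meets (oD n).2 oO (x := point_of s \o f).
  by rewrite /= fgE.
by exists (y \o g) => //=; rewrite gfE.
Qed.

(* For complementary [M] and [M'] this is the Baire property. *)
Definition category_split M M' := forall s, exists2 r,
  cylinder r `<=` cylinder s &
  meagre (cylinder r `&` M) \/ meagre (cylinder r `&` M').

Lemma category_splitC M M' : category_split M M' -> category_split M' M.
Proof.
by move=> H s; have [r rs [?|?]] := H s; exists r => //; [right|left].
Qed.

(** Banach category theorem. The cylinders in which [M] is meagre, together with the exterior of
    [O], form a dense open set [E]; there are only countably many cylinders, so inside [O] the set
    [M] is covered by a meagre union and the complement of [E]. *)
Lemma meagre_local O M :
  (forall s, cylinder s `<=` O -> exists2 r, cylinder r `<=` cylinder s &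
     meagre (cylinder r `&` M)) ->
  cyl_open O -> meagre (O `&` M).
Proof.
move=> HM oO.
pose N s := if `[< meagre (cylinder s `&` M) >] then cylinder s else set0.
pose E := [set x | (exists s, N s x) \/ exists n, agree n x `<=` ~` O].
have mN : meagre (\bigcup_s (N s `&` M)).
  apply: meagre_bigcup => s; rewrite /N; case: asboolP => // _.
  by rewrite set0I; exact: meagre0.
have mE : meagre (~` E).
  apply: meagre_nowhere_dense => [x|s].
    case=> [[s]|[n nO]]; last first.
      by exists n => y xy; right; exists n => z /(agree_trans xy); exact: nO.
    rewrite /N; case: asboolP => // ms sx.
    have [n ns] := cylinder_open sx; exists n => y /ns sy.
    by left; exists s; rewrite /N; case: asboolP.
  have [[x [sx Ox]]|nsO] := pselect (exists x, cylinder s x /\ O x).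
    have [r [_ rsO _]] :=
      cyl_open_cylinder 0 (cyl_openI (@cylinder_open s) oO) (conj sx Ox).
    have [|q qr mq] := HM r; first by move=> y /rsO[].
    exists (point_of q).
      by have [] := rsO _ (qr _ (@cylinder_point_of q)).
    by left; exists q; rewrite /N; case: asboolP.
  exists (point_of s) => //; right; exists (size s) => y sy Oy.
  by apply: nsO; exists y; split=> //; exact: agree_sym.
apply: meagre_sub (meagreU mN mE) => x [Ox Mx].
have [Ex|nEx] := pselect (E x); last by right.
case: Ex => [[s Nx]|[n nO]]; first by left; exists s.
by case: (nO x).
Qed.

(** If some [M' n] is meagre in a subcylinder, so is the intersection. Otherwise each [M n] is
    meagre in a subcylinder of every cylinder inside [s], and [meagre_local] makes it meagre in all
    of [s]. *)
Lemma category_split_bigcup (M M' : nat -> set X) :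
  (forall n, category_split (M n) (M' n)) ->
  category_split (\bigcup_n M n) (\bigcap_n M' n).
Proof.
move=> HM s.
have [[n [r [rs mr]]]|nex] := pselect (exists n r,
    cylinder r `<=` cylinder s /\ meagre (cylinder r `&` M' n)).
  exists r => //; right; apply: meagre_sub mr => x [rx M'x].
  by split=> //; exact: M'x.
exists s => //; left; rewrite setI_bigcupr.
apply: meagre_bigcup => n; apply: meagre_local; last exact: cylinder_open.
move=> r rs; have [q qr [mq|mq]] := HM n r; first by exists q.
by case: nex; exists n, q; split=> //; exact: subset_trans qr rs.
Qed.

(** * The Baire property of Borel sets and Borel maps *)

Lemma open_cyl_open (O : set (prod_topology (fun _ : T => bool))) :
  open O -> cyl_open O.
Proof.
move=> oO x Ox.
(* The filter of basic neighbourhoods of [x]; its convergence to [x] in the product topology is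
   checked coordinate by coordinate. *)
pose F : set_system (prod_topology (fun _ : T => bool)) :=
  filter_from setT (agree^~ x).
have FF : Filter F.
  apply: filter_from_filter; first by exists 0%N.
  move=> m n _ _; exists (maxn m n) => // y xy.
  by split; apply: agree_le xy; lia.
have cF : F --> (x : prod_topology (fun _ : T => bool)).
  apply/cvg_sup => h A [_ [[B _ <-] Bx BA]].
  exists (pickle h).+1 => // y /(_ h (ltnSn _)) xy; apply: BA.
  by rewrite -[_ y]/(B (y h)) -xy.
have [n _ nO] := cF O (open_nbhs_nbhs (conj oO Ox)).
by exists n.
Qed.

(** The sets with this property form a sigma-algebra containing the relatively open sets.
    Complements are taken within [A], hence the two images. *)
Lemma borel_category_split (A : set (prod_topology (fun _ : T => bool)))
    (B : set (set_type A)) :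
  borel_set B -> category_split (set_val @` B) (set_val @` (~` B)).
Proof.
apply: (@smallest_sub _ _ _
  [set B | category_split (set_val @` B) (set_val @` (~` B))]).
  split=> [s|C HC|C HC].
  - by exists s => //; left; apply: meagre_sub meagre0 => x [_ [y []]].
  - by rewrite /= setTD setCK; exact: category_splitC.
  move=> s; have [r rs H] := category_split_bigcup HC s; exists r => //.
  case: H => H; [left|right]; apply: meagre_sub H => x [rx [y Cy yx]];
    split=> //.
    by case: Cy => n _ Cy; exists n => //; exists y.
  by move=> n _; exists y => // Cny; apply: Cy; exists n.
move=> U [V oV <-] s.
have [[x [sx Vx]]|nsV] := pselect (exists x, cylinder s x /\ V x).
  have [r [_ rsV _]] := cyl_open_cylinder 0
    (cyl_openI (@cylinder_open s) (open_cyl_open oV)) (conj sx Vx).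
  exists r; first by move=> y /rsV[].
  right; apply: meagre_sub meagre0 => x' [rx' [y nVy yx']].
  by apply: nVy; rewrite /preimage /= yx'; have [] := rsV _ rx'.
exists s => //; left; apply: meagre_sub meagre0 => x [sx [y Vy yx]].
by apply: nsV; exists x; split=> //; rewrite -yx.
Qed.

(** The values are tried one at a time: each is either taken off a meagre set in some subcylinder,
    or itself confined to a meagre set there. *)
Lemma borel_fun_decided (A : set (prod_topology (fun _ : T => bool)))
    (I : finType) (c : set_type A -> I) (s : seq bool) (i0 : I) :
  (forall C : set I, borel_set (c @^-1` C)) ->
  exists r i, cylinder r `<=` cylinder s /\
    meagre (cylinder r `&` set_val @` [set x | c x <> i]).
Proof.
move=> cB.
suff H (l : seq I) : exists r, cylinder r `<=` cylinder s /\
    ((exists i, meagre (cylinder r `&` set_val @` [set x | c x <> i])) \/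
     meagre (cylinder r `&` set_val @` [set x | c x \in l])).
  have [r [rs [[i mi]|me]]] := H (enum I); first by exists r, i.
  (* Every value has been ruled out, so [A] is meagre in this cylinder and any value serves. *)
  exists r, i0; split=> //; apply: meagre_sub me => x [rx [y _ yx]].
  by split=> //; exists y => //=; rewrite mem_enum.
elim: l => [|j l [r [rs IH]]].
  by exists s; split=> //; right; apply: meagre_sub meagre0 => x [_ [y]].
case: IH => [[i mi]|ml]; first by exists r; split=> //; left; exists i.
have [q qr [mq|mq]] := borel_category_split (cB [set j]) r.
  exists q; split; first exact: subset_trans rs.
  right; apply: meagre_sub (meagreU mq ml) => x [qx [y + yx]] /=.
  rewrite /mkset in_cons => /predU1P[yj|yl]; [left|right].
    by split=> //; exists y.
  by split; [exact: qr|exists y].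
exists q; split; first exact: subset_trans rs.
by left; exists j.
Qed.

End CantorCategory.

(** * The shift action and its free part *)

Lemma shift_mul (G : groupType) (g h : G) (x : shift_space G) :
  shift g (shift h x) = shift (g * h)%g x.
Proof. by apply/funext => k; rewrite /shift invgM mulgA. Qed.

Lemma shift_id (G : groupType) (x : shift_space G) : shift 1%g x = x.
Proof. by apply/funext => k; rewrite /shift invg1 mul1g. Qed.

Lemma free_part_shift (G : groupType) (g : G) (x : shift_space G) :
  free_part x -> free_part (shift g x).
Proof.
move=> Fx k k1 kE; apply: (Fx (g^-1 * k * g)%g).
  move=> gkg; apply: k1; apply: (mulIg g); apply: (mulgI g^-1%g).
  by rewrite mulgA gkg mul1g mulVg.
by rewrite -!shift_mul kE shift_mul mulVg shift_id.
Qed.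

Arguments free_part_shift {G} g {x}.

(** * Winding numbers of closed walks in the triangle *)

(** The sign of a move along the triangle oriented as 0, 1, 2, 0. Equal colours get the junk value
    -1. *)
Definition step (i j : 'I_3) : int :=
  if j == (i.+1 %% 3)%N :> nat then 1 else - 1.

Lemma stepC (i j : 'I_3) : i != j -> step j i = - step i j.
Proof. by move: i j => [[|[|[|?]]] ?] [[|[|[|?]]] ?]. Qed.

(** The winding number along a 4-cycle is 0, written as equality along its two paths from [p] to
    [q']. *)
Lemma step_square (p p' q q' : 'I_3) :
  p != p' -> q != q' -> p != q -> p' != q' ->
  step p p' + step p' q' = step p q + step q q'.
Proof.
by move: p p' q q' => [[|[|[|?]]] ?] [[|[|[|?]]] ?];
move=> [[|[|[|?]]] ?] [[|[|[|?]]] ?].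
Qed.

Definition winding5 (i j k l m : 'I_3) : int :=
  step i j + step j k + step k l + step l m + step m i.

(** A closed sum of five signs is odd, a multiple of 3, and at most 5 in size; here the colours are
    enumerated. *)
Lemma winding5_neq0 (i j k l m : 'I_3) :
  i != j -> j != k -> k != l -> l != m -> m != i ->
  winding5 i j k l m = 3 \/ winding5 i j k l m = - 3.
Proof.
move: i j k l m => [[|[|[|?]]] ?] [[|[|[|?]]] ?] [[|[|[|?]]] ?];
by move=> [[|[|[|?]]] ?] [[|[|[|?]]] ?] // *; by [left|right].
Qed.

(** Summing the relations of the five side squares cancels the rungs of the prism. *)
Lemma winding5_prism (p0 p1 p2 p3 p4 q0 q1 q2 q3 q4 : 'I_3) :
  p0 != p1 -> p1 != p2 -> p2 != p3 -> p3 != p4 -> p4 != p0 ->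
  q0 != q1 -> q1 != q2 -> q2 != q3 -> q3 != q4 -> q4 != q0 ->
  p0 != q0 -> p1 != q1 -> p2 != q2 -> p3 != q3 -> p4 != q4 ->
  winding5 p0 p1 p2 p3 p4 = winding5 q0 q1 q2 q3 q4.
Proof.
move=> p01 p12 p23 p34 p40 q01 q12 q23 q34 q40 e0 e1 e2 e3 e4.
rewrite /winding5.
have := step_square p01 q01 e0 e1; have := step_square p12 q12 e1 e2.
have := step_square p23 q23 e2 e3; have := step_square p34 q34 e3 e4.
have := step_square p40 q40 e4 e0.
move=> {p01 p12 p23 p34 p40 q01 q12 q23 q34 q40 e0 e1 e2 e3 e4}.
lia.
Qed.

Lemma winding5_rev (i j k l m : 'I_3) :
  i != j -> j != k -> k != l -> l != m -> m != i ->
  winding5 l k j i m = - winding5 i j k l m.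
Proof.
move=> ij jk kl lm mi; rewrite /winding5.
rewrite (stepC ij) (stepC jk) (stepC kl) (stepC lm) (stepC mi).
by move=> {ij jk kl lm mi}; lia.
Qed.

(** * Category in the shift space of [Delta] *)

Lemma Delta_mulE (a m b n : int) :
  (((a, m) : Delta) * ((b, n) : Delta))%g = (a + (-1) ^ m * b, m + n) :> Delta.
Proof. by []. Qed.

HB.instance Definition _ := Countable.on Delta.

Lemma meagre_shift (g : Delta) (M : set (shift_space Delta)) :
  meagre M -> meagre [set x : shift_space Delta | M (shift g x)].
Proof.
exact: (@meagre_comp Delta (fun h => g^-1 * h)%g (fun h => g * h)%g M
  (mulVKg g) (mulKg g)).
Qed.

Lemma cyl_open_shift (g : Delta) (O : set (shift_space Delta)) :
  cyl_open (T := Delta) O ->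
  cyl_open (T := Delta) [set x : shift_space Delta | O (shift g x)].
Proof. exact: cyl_open_comp. Qed.

Lemma meagre_not_free : meagre (T := Delta) (~` @free_part Delta).
Proof.
pose N (g : Delta) := if g == 1%g then set0
  else ~` [set x : shift_space Delta | shift g x <> x].
apply: (@meagre_sub Delta _ (\bigcup_g N g)) => [x nFx|].
  apply: contrapT => nN; apply: nFx => g g1 gx; apply: nN; exists g => //.
  by rewrite /N; case: eqP => // _ /(_ gx).
apply: meagre_bigcup => g; rewrite /N; case: eqP => [_|/eqP g1].
  exact: meagre0.
apply: meagre_nowhere_dense => [x /= gx|s].
  have [h xh] : exists h, x (g^-1 * h)%g <> x h.
    apply: contrapT => nh; apply: gx; apply/funext => h.
    by apply: contrapT => xh; apply: nh; exists h.
  exists (maxn (pickle (g^-1 * h)%g) (pickle h)).+1 => y xy /=.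
  move=> /(congr1 (@^~ h)).
  by rewrite /shift -!xy ?ltnS ?leq_maxl ?leq_maxr.
have [N0 HN] := pickle_bounded (fun h : Delta => `|h.2|%N) (size s).
(* The second coordinates of [h] and of [g^-1 * h] are both at least [N0], so the cylinder [s]
   constrains neither position. *)
pose h : Delta := (0, (N0 + `|g.2|)%:Z).
have hs : (size s <= pickle h)%N.
  by rewrite leqNgt; apply/negP => /HN /=; lia.
have ghs : (size s <= pickle (g^-1 * h)%g)%N.
  rewrite leqNgt; apply/negP => /HN.
  rewrite -[(g^-1 * h)%g.2]/(- g.2 + (N0 + `|g.2|)%:Z); lia.
(* Outside [s] this is the indicator of [h], so it differs from its shift by [g] at [h]. *)
exists (fun k : Delta =>
  if (pickle k < size s)%N then point_of s k else k == h).
  by move=> k ks; rewrite ks.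
move=> /(congr1 (@^~ h)); rewrite /shift !ltnNge hs ghs /= eqxx => /eqP.
move=> /(congr1 (fun k => g * k)%g); rewrite mulVKg -{1}[h]mul1g.
by move=> /mulIg /esym; exact/eqP.
Qed.

(** * Orientations of pentagons under a Borel 3-colouring *)

(** Chosen so that [(k, 0) * flip = (0, 1) * (6 - k, 0)]: the reflection [k] to [6 - k] preserves
    the pentagon 0, 2, 4, 6, 3 and reverses it. *)
Definition flip : Delta := (- 6, 1).

Section Coloring.
Variable c : set_type (@free_part Delta) -> 'I_3.
Hypothesis c_col : borel_coloring (@shift_graph Delta_marked) c.

(** Made total by the default [ord0], so that category arguments run in the full shift space; the
    non-free points are meagre. *)
Definition ext_color (x : shift_space Delta) : 'I_3 := oapp c ord0 (insub x).

Lemma ext_colorE y : ext_color (set_val y) = c y.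
Proof. by rewrite /ext_color valK. Qed.

Lemma ext_color_neq (s : Delta) x : s \in Delta_gens -> free_part x ->
  ext_color x != ext_color (shift s x).
Proof.
move=> sS Fx; apply/eqP.
have sx := free_part_shift s Fx.
have -> : x = set_val (exist (fun x => x \in _) x (mem_set Fx)) by [].
have -> : shift s (set_val (exist (fun x => x \in _) x (mem_set Fx))) =
  set_val (exist (fun x => x \in _) _ (mem_set sx)) by [].
rewrite !ext_colorE; apply: c_col.2; split; last by exists s.
move=> /(congr1 set_val) /= /esym; apply: Fx => s1.
by have := Delta_gens_neq1; rewrite -s1 sS.
Qed.

Definition orientation (x : shift_space Delta) : bool :=
  let C k := ext_color (shift ((k, 0) : Delta) x) in
  winding5 (C 0) (C 2) (C 4) (C 6) (C 3) == 3.

(* The translate by [(0, 1)] of the pentagon at [x] is the pentagon at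
   [shift flip x] traversed backwards, because [(0, 1)] inverts [Z]. *)
Lemma orientation_flip x : free_part x ->
  orientation (shift flip x) = ~~ orientation x.
Proof.
move=> Fx; rewrite /orientation.
set p := fun k => ext_color (shift ((k, 0) : Delta) x).
set q := fun k => ext_color (shift ((k, 0) : Delta) (shift flip x)).
have shE y (s j : int) :
    shift ((s, 0) : Delta) (shift ((j, 0) : Delta) y) =
    shift ((s + j, 0) : Delta) y.
  by rewrite shift_mul Delta_mulE expr0z mul1r.
have edge y s j : free_part y -> ((s, 0) : Delta) \in Delta_gens ->
    ext_color (shift ((j, 0) : Delta) y) !=
    ext_color (shift ((s + j, 0) : Delta) y).
  move=> Fy sS; rewrite -shE.
  by apply: ext_color_neq => //; exact: free_part_shift.
have Fux := free_part_shift flip Fx.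
have pq j : p j != q (6 - j).
  have -> : q (6 - j) =
      ext_color (shift ((0, 1) : Delta) (shift ((j, 0) : Delta) x)).
    rewrite /q !shift_mul !Delta_mulE expr0z expr1z !add0r addr0 mul1r mulN1r.
    by rewrite addrAC subrr add0r.
  by apply: ext_color_neq => //; exact: free_part_shift.
have p2 j : p j != p (2 + j) by exact: edge.
have p3 j : p j != p (-3 + j) by exact: edge.
have q2 j : q j != q (2 + j) by exact: edge.
have q3 j : q j != q (-3 + j) by exact: edge.
have q2' j : q (2 + j) != q j by rewrite eq_sym.
have q3' j : q (-3 + j) != q j by rewrite eq_sym.
have pW := winding5_neq0 (p2 0) (p2 2) (p2 4) (p3 6) (p3 3).
(* The second pentagon is listed as 6, 4, 2, 0, 3, so that the rungs are the edges [pq]. *)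
have W := winding5_prism (p2 0) (p2 2) (p2 4) (p3 6) (p3 3)
  (q2' 4) (q2' 2) (q2' 0) (q3' 3) (q3' 6) (pq 0) (pq 2) (pq 4) (pq 6) (pq 3).
have qW := winding5_rev (q2 0) (q2 2) (q2 4) (q3 6) (q3 3).
(* The indices arise as sums such as [2 + 4] and [-3 + 6], which compute to the vertices. *)
change (winding5 (q 6) (q 4) (q 2) (q 0) (q 3) =
  - winding5 (q 0) (q 2) (q 4) (q 6) (q 3)) in qW.
change (winding5 (p 0) (p 2) (p 4) (p 6) (p 3) =
  winding5 (q 6) (q 4) (q 2) (q 0) (q 3)) in W.
change (winding5 (p 0) (p 2) (p 4) (p 6) (p 3) = 3 \/
  winding5 (p 0) (p 2) (p 4) (p 6) (p 3) = - 3) in pW.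
rewrite -[winding5 (q 0) _ _ _ _]opprK -qW -W.
by case: pW => ->.
Qed.

Lemma orientation_flip_odd x n : free_part x ->
  orientation (shift (flip ^+ n)%g x) = odd n (+) orientation x.
Proof.
move=> Fx; elim: n => [|n IHn]; first by rewrite expg0 shift_id.
rewrite expgS -shift_mul orientation_flip ?IHn ?addNb //.
exact: free_part_shift.
Qed.

(** A cylinder inside the translate of [s] by [g] is refined until [c] is decided, and the outcome
    is pulled back along [g]. *)
Lemma ext_color_decided (g : Delta) s : exists r i,
  cylinder (T := Delta) r `<=` cylinder s /\
  meagre (cylinder r `&` [set x | ext_color (shift g x) <> i]).
Proof.
have shiftK (h : Delta) x : shift h (shift h^-1%g x) = x.
  by rewrite shift_mul mulgV shift_id.
have shiftVK (h : Delta) x : shift h^-1%g (shift h x) = x.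
  by rewrite shift_mul mulVg shift_id.
have [|s1 [_ s1s _]] := cyl_open_cylinder 0
  (cyl_open_shift (g := g^-1%g) (@cylinder_open Delta s))
  (x := shift g (@point_of Delta s)).
  by rewrite /= shiftVK.
have [r1 [i [r1s1 mr1]]] := borel_fun_decided s1 ord0 c_col.1.
have [|r [_ rr1 _]] := cyl_open_cylinder 0
  (cyl_open_shift (g := g) (@cylinder_open Delta r1))
  (x := shift g^-1%g (@point_of Delta r1)).
  by rewrite /= shiftK.
exists r, i; split=> [x /rr1 /= /r1s1 /s1s /=|]; first by rewrite shiftVK.
apply: meagre_sub (meagre_shift g (meagreU mr1 meagre_not_free)) => x [rx Cx].
have [Fgx|] := pselect (@free_part Delta (shift g x)); last by right.
left; split; first exact: rr1.
exists (exist (fun x => x \in _) _ (mem_set Fgx)) => //=.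
by rewrite -ext_colorE.
Qed.

(** The orientation depends on the colours of five translates; the cylinder is shrunk once for
    each. *)
Lemma orientation_decided : exists s b,
  meagre (T := Delta) (cylinder s `&` [set x | orientation x <> b]).
Proof.
have H (l : seq Delta) : exists r (v : Delta -> 'I_3),
    meagre (cylinder r `&` [set x | exists2 g, g \in l &
      ext_color (shift g x) <> v g]).
  elim: l => [|g l [s [v ms]]].
    exists [::], (fun=> ord0).
    by apply: (@meagre_sub Delta _ set0); [move=> x [_ []]|exact: meagre0].
  have [r [i [rs mr]]] := ext_color_decided g s.
  exists r, (fun h => if h == g then i else v h).
  apply: meagre_sub (meagreU mr ms) => x [rx [h]].
  rewrite in_cons; case: eqP => [->|_] /= hl xh; first by left.
  by right; split; [exact: rs|exists h].
have [s [v ms]] := H [:: (0, 0); (2, 0); (4, 0); (6, 0); (3, 0)].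
exists s,
  (winding5 (v (0, 0)) (v (2, 0)) (v (4, 0)) (v (6, 0)) (v (3, 0)) == 3).
apply: meagre_sub ms => x [sx ox]; split=> //.
apply: contrapT => nex; apply: ox; rewrite /orientation.
have E g : g \in [:: (0, 0); (2, 0); (4, 0); (6, 0); (3, 0)] ->
    ext_color (shift (g : Delta) x) = v g.
  by move=> gl; apply: contrapT => ne; apply: nex; exists g.
by rewrite !E.
Qed.

Lemma borel_3_coloring_absurd : False.
Proof.
have [s [b ms]] := orientation_decided.
have [N HN] := pickle_bounded (fun h : Delta => `|h.2|%N) (size s).
(* Odd, so that [u] reverses orientation, and so large that [u^-1] moves every position constrained
   by [s] to an unconstrained one. *)
pose n := N.*2.+1.
pose u : Delta := (flip ^+ n)%g.
have u2 : u.2 = n%:Z.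
  rewrite /u; elim: (n) => [|m IHm]; first by rewrite expg0.
  by rewrite expgS -[LHS]/(1 + ((flip ^+ m)%g : Delta).2) IHm; lia.
pose O := cylinder s `&` [set x : shift_space Delta | cylinder s (shift u x)].
have oO : cyl_open (T := Delta) O.
  apply: cyl_openI; first exact: cylinder_open.
  by apply: cyl_open_shift; exact: cylinder_open.
pose y : shift_space Delta := fun h : Delta =>
  if (pickle h < size s)%N then point_of s h else point_of s (u * h)%g.
have Oy : O y.
  split=> h hs; first by rewrite /y hs.
  rewrite /shift /y ifF ?mulVKg //; apply/negP => /HN; have := HN _ hs.
  rewrite -[(u^-1 * h)%g.2]/(- u.2 + h.2) u2 /n; lia.
apply: not_meagre_open oO Oy _.
(* For free [x] in [O], the orientations of [x] and [shift u x] differ, so one of them is not [b];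
   thus [O] would be meagre. *)
apply: meagre_sub (meagreU (meagreU ms (meagre_shift u ms)) meagre_not_free).
move=> x [sx sux].
have [Fx|] := pselect (@free_part Delta x); last by right.
left; have [xb|] := pselect (orientation x = b); last by left.
right; split=> //=; rewrite orientation_flip_odd // xb /n /= odd_double /=.
by case: b {ms xb}.
Qed.

End Coloring.

Theorem theorem13 :
  (3%:E < borel_chromatic_number (@shift_graph Delta_marked))%E.
Proof.
rewrite /borel_chromatic_number; case: pselect => [ex|_]; last exact: ltry.
case: ex_minnP => k /asboolP[c [cB cE]] _.
rewrite lte_fin ltz_nat ltnNge; apply/negP => k3.
(* A colouring with at most 3 colours is read as one with exactly 3 available. *)
apply: (@borel_3_coloring_absurd (widen_ord k3 \o c)); split=> [C|x y xy].
  by rewrite comp_preimage; exact: cB.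
by move=> /= /(congr1 val) /= /val_inj; exact: cE xy.
Qed.
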